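(* Let $N\ge 1$, $n\ge 1$ be integers, let $\sigma>0$, $B>0$, and $\lambda_1,\dots,\lambda_N>0$. Put $\rho = n/\sigma^2$, $\kappa = \sqrt{2\ln(1.25\,n^2)}\,B/n$ and $$\zeta_i = \frac{\lambda_i}{\lambda_i+\kappa^2\rho^2}\quad (i=1,\dots,N).$$ Consider the system of participation constraints in the unknowns $\beta_1,\dots,\beta_N\in[0,\rho)$, where $\gamma_i=\sum_{k\ne i}\beta_k$: $$\forall i\in\{1,\dots,N\}:\qquad -\frac{\kappa^2\rho\,\beta_i}{\rho-\beta_i}+\frac{\lambda_i\gamma_i}{\rho(\gamma_i+\rho)}\ \ge\ 0. \qquad (\ast)$$ Then $(\ast)$ has a solution $(\beta_1,\dots,\beta_N)\neq(0,\dots,0)$ if and only if $$\sum_{i=1}^N\zeta_i>1 .$$ Moreover, if this condition holds, then for every $b\in\left[0,\left(1-\frac{1}{\sum_{i=1}^N\zeta_i}\right)\rho\right]$ the choice $\beta_i=\zeta_i b$, $i=1,\dots,N$, is a solution of $(\ast)$.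
   Context: Setting (differentially private mean estimation). Client $i\in\{1,\dots,N\}$ holds $n$ independent samples with mean $\mu$ and variance $\sigma^2$, supported in $[\mu-B/2,\mu+B/2]$, and reveals its sample mean plus Gaussian noise $N(0,\alpha_i^2)$. Write $\beta_i = 1/(1/\rho+\alpha_i^2)$ for the informativeness of client $i$'s message; $\beta_i=0$ corresponds to $\alpha_i=\infty$ (no participation). The accuracy loss of client $i$ is $\mathrm{Err}_i=\sqrt{1/(\gamma_i+\rho)}$, its privacy loss is $\mathrm{Leak}_i=\kappa/\alpha_i$, and its utility is $u_i=-\mathrm{Leak}_i^2-\lambda_i\mathrm{Err}_i^2=-\kappa^2/\alpha_i^2-\lambda_i/(\gamma_i+\rho)$. The utility of local training is $u_i^0=-\lambda_i/\rho$. A protocol is mutually beneficial if $u_i\ge u_i^0$ for every $i$; this is exactly the system $(\ast)$. *)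

(* Defs.v *)
From HB Require Import structures.
From mathcomp Require Import all_boot all_order all_algebra.
From mathcomp Require Import reals exp.

Set Implicit Arguments.
Unset Strict Implicit.
Unset Printing Implicit Defensive.

Import Order.TTheory GRing.Theory Num.Theory.

Local Open Scope ring_scope.

Section Participation.
Variable R : realType.

Definition rho (n : nat) (sigma : R) : R := n%:R / sigma ^+ 2.

(* The constant 5 / 4 is 1.25. *)
Definition kappa (n : nat) (B : R) : R :=
  Num.sqrt (2 * ln (5 / 4 * n%:R ^+ 2)) * B / n%:R.

Section Clients.
Variables (N n : nat) (sigma B : R) (lambda : 'I_N -> R).

Definition zeta (i : 'I_N) : R :=
  lambda i / (lambda i + kappa n B ^+ 2 * rho n sigma ^+ 2).

Definition gamma (beta : 'I_N -> R) (i : 'I_N) : R :=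
  \sum_(k < N | k != i) beta k.

(* The utility gain of client i over local training, with its noise variance
   alpha_i ^+ 2 eliminated through
   1 / alpha_i ^+ 2 = rho * beta i / (rho - beta i). *)
Definition gain (beta : 'I_N -> R) (i : 'I_N) : R :=
  - (kappa n B ^+ 2 * rho n sigma * beta i / (rho n sigma - beta i))
  + lambda i * gamma beta i / (rho n sigma * (gamma beta i + rho n sigma)).

(* The range of the unknowns, [0, rho), is part of being a solution. *)
Definition participation_solution (beta : 'I_N -> R) : Prop :=
  (forall i, 0 <= beta i < rho n sigma) /\ (forall i, gain beta i >= 0).

End Clients.
End Participation.

(* Main.v *)
Require Import Defs.
From mathcomp Require Import all_boot all_order all_algebra.
From mathcomp Require Import reals exp.
From mathcomp Require boolp.
From mathcomp Require Import ring lra.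

Set Implicit Arguments.
Unset Strict Implicit.
Unset Printing Implicit Defensive.

Import Order.TTheory GRing.Theory Num.Theory.

Local Open Scope ring_scope.

(** Write [S] for the sum of all [beta k], [Z] for the sum of all [zeta k].
    Clearing denominators, constraint [i] becomes
    [beta i * (gamma i + rho) <= zeta i * S * rho].
    Summing over [i] gives [S * rho + \sum_i beta i * gamma i <= Z * S * rho],
    and the cross term is positive at a nonzero solution, because a client with
    [beta i > 0] must have [gamma i > 0].  For [beta i = zeta i * b] one has
    [S = Z * b], and the constraint reduces to
    [Z * b - zeta i * b + rho <= Z * rho]. *)

Lemma rho_gt0 (R : realType) (n : nat) (sigma : R) :
  (0 < n)%N -> 0 < sigma -> 0 < rho n sigma.
Proof. by move=> n0 s0; rewrite divr_gt0 ?exprn_gt0 ?ltr0n. Qed.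

(** Since [n >= 1], the argument of the logarithm is at least 5/4, so the logarithm is positive. *)
Lemma kappa_gt0 (R : realType) (n : nat) (B : R) :
  (0 < n)%N -> 0 < B -> 0 < kappa n B.
Proof.
move=> n0 B0; rewrite divr_gt0 ?ltr0n// mulr_gt0// sqrtr_gt0.
rewrite mulr_gt0// ln_gt0//.
have n1 : 1 <= n%:R ^+ 2 :> R by rewrite exprn_ege1 // ler1n.
by lra.
Qed.

Lemma zeta_itv (R : realType) (N n : nat) (sigma B : R) (lambda : 'I_N -> R)
    (i : 'I_N) :
  (0 < n)%N -> 0 < sigma -> 0 < B -> 0 < lambda i ->
  0 < zeta n sigma B lambda i < 1.
Proof.
move=> n0 s0 B0 l0; rewrite /zeta.
have c0 : 0 < kappa n B ^+ 2 * rho n sigma ^+ 2.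
  by rewrite mulr_gt0 ?exprn_gt0 ?kappa_gt0 ?rho_gt0.
have lc0 := addr_gt0 l0 c0.
by rewrite divr_gt0//= ltr_pdivrMr// mul1r ltrDl.
Qed.

Lemma gamma_ge0 (R : realType) (N : nat) (beta : 'I_N -> R) (i : 'I_N) :
  (forall k, 0 <= beta k) -> 0 <= gamma beta i.
Proof. by move=> b0; rewrite sumr_ge0. Qed.

Lemma sum_gamma (R : realType) (N : nat) (beta : 'I_N -> R) (i : 'I_N) :
  \sum_(k < N) beta k = beta i + gamma beta i.
Proof. by rewrite (bigD1 i). Qed.

Lemma gain_ge0 (R : realType) (N n : nat) (sigma B : R) (lambda : 'I_N -> R)
    (beta : 'I_N -> R) (i : 'I_N) :
  (0 < n)%N -> 0 < sigma -> 0 < B -> 0 < lambda i ->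
  (forall k, 0 <= beta k < rho n sigma) ->
  (0 <= gain n sigma B lambda beta i) =
  (beta i * (gamma beta i + rho n sigma) <=
   zeta n sigma B lambda i * (\sum_(k < N) beta k) * rho n sigma).
Proof.
move=> n0 s0 B0 l0 hb.
have r0 := rho_gt0 n0 s0; have k0 := kappa_gt0 n0 B0.
have /andP[b0 br] := hb i.
have g0 : 0 <= gamma beta i by apply: gamma_ge0 => k; case/andP: (hb k).
rewrite (sum_gamma beta i) /gain /zeta.
move: (rho n sigma) (kappa n B) (gamma beta i) (beta i) (lambda i)
  r0 k0 g0 b0 br l0 => r k g b l r0 k0 g0 b0 br l0 {hb}.
have lc0 : 0 < l + k ^+ 2 * r ^+ 2.
  by rewrite addr_gt0// mulr_gt0 ?exprn_gt0.
have rb0 : 0 < r - b by rewrite subr_gt0.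
have gr0 : 0 < g + r by rewrite ltr_wpDl.
(* Over the common denominator [r * (r - b) * (g + r)] the terms [l * b * r] cancel, so the gain is
   a multiple of the gap between the two sides of the cleared inequality. The factor is positive
   because [b < r]. *)
have -> : - (k ^+ 2 * r * b / (r - b)) + l * g / (r * (g + r)) =
    (l + k ^+ 2 * r ^+ 2) / (r * (r - b) * (g + r)) *
    (l / (l + k ^+ 2 * r ^+ 2) * (b + g) * r - b * (g + r)).
  by field; rewrite exprMn !gt_eqF.
by rewrite pmulr_rge0 ?subr_ge0// divr_gt0// !mulr_gt0.
Qed.

(** A lone participant gains nothing: if [gamma beta i = 0], the sum of all [beta k] is [beta i],
    and the cleared constraint becomes [beta i <= zeta i * beta i], contradicting [zeta i < 1]. *)
Lemma gamma_gt0 (R : realType) (N n : nat) (sigma B : R) (lambda : 'I_N -> R)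
    (beta : 'I_N -> R) (i : 'I_N) :
  (0 < n)%N -> 0 < sigma -> 0 < B -> (forall k, 0 < lambda k) ->
  participation_solution n sigma B lambda beta ->
  0 < beta i -> 0 < gamma beta i.
Proof.
move=> n0 s0 B0 l0 [hb hg] bi0.
have b0 k : 0 <= beta k by case/andP: (hb k).
have := gamma_ge0 i b0; rewrite le_eqVlt => /orP[/eqP g0|//].
have := hg i; rewrite gain_ge0// (sum_gamma beta i) -g0 addr0 add0r.
rewrite ler_pM2r ?rho_gt0// ler_pMl//.
by have /andP[_ /lt_geF ->] := zeta_itv n0 s0 B0 (l0 i).
Qed.

Lemma sum_zeta_gt1 (R : realType) (N n : nat) (sigma B : R)
    (lambda : 'I_N -> R) (beta : 'I_N -> R) (i : 'I_N) :
  (0 < n)%N -> 0 < sigma -> 0 < B -> (forall k, 0 < lambda k) ->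
  participation_solution n sigma B lambda beta ->
  0 < beta i -> 1 < \sum_(k < N) zeta n sigma B lambda k.
Proof.
move=> n0 s0 B0 l0 sol bi0; have [hb hg] := sol.
have b0 k : 0 <= beta k by case/andP: (hb k).
have g0 k : 0 <= gamma beta k by exact: gamma_ge0.
have r0 := rho_gt0 n0 s0.
set S := \sum_(k < N) beta k.
have S0 : 0 < S by rewrite /S (sum_gamma beta i) ltr_pwDl.
(* The term of client [i] alone is positive; the others are nonnegative. *)
have cross0 : 0 < \sum_(k < N) beta k * gamma beta k.
  rewrite (bigD1 i)//= ltr_pwDl//; last by rewrite sumr_ge0// => k _; exact: mulr_ge0.
  by rewrite mulr_gt0//; exact: gamma_gt0 sol bi0.
have : \sum_(k < N) beta k * (gamma beta k + rho n sigma) <=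
    \sum_(k < N) zeta n sigma B lambda k * S * rho n sigma.
  by apply: ler_sum => k _; rewrite -gain_ge0.
rewrite -!mulr_suml (eq_bigr _ (fun k _ => mulrDr _ _ _)) big_split/= -mulr_suml.
move=> le_ZSr; rewrite -(ltr_pM2r S0) -(ltr_pM2r r0) mul1r.
by apply: lt_le_trans le_ZSr; rewrite ltrDr.
Qed.

Lemma zeta_solution (R : realType) (N n : nat) (sigma B : R)
    (lambda : 'I_N -> R) (b : R) :
  (0 < n)%N -> 0 < sigma -> 0 < B -> (forall k, 0 < lambda k) ->
  1 < \sum_(k < N) zeta n sigma B lambda k ->
  0 <= b <= (1 - 1 / \sum_(k < N) zeta n sigma B lambda k) * rho n sigma ->
  participation_solution n sigma B lambda
    (fun k => zeta n sigma B lambda k * b).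
Proof.
move=> n0 s0 B0 l0; set Z := \sum_(k < N) _ => Z1 /andP[b0 bZ].
have r0 := rho_gt0 n0 s0.
have Z0 : 0 < Z := lt_trans ltr01 Z1.
(* Multiplying the bound on [b] by [Z] removes the division and leaves a linear inequality. *)
have Zb : Z * b <= (Z - 1) * rho n sigma.
  have -> : (Z - 1) * rho n sigma = Z * ((1 - 1 / Z) * rho n sigma).
    by field; rewrite gt_eqF.
  by rewrite ler_pM2l.
have br : b < rho n sigma.
  by apply: le_lt_trans bZ _; rewrite gtr_pMl// gtrBl divr_gt0.
have hz k : 0 < zeta n sigma B lambda k < 1 by exact: zeta_itv.
have hb k : 0 <= zeta n sigma B lambda k * b < rho n sigma.
  have /andP[z0 z1] := hz k.
  apply/andP; split; first by rewrite mulr_ge0 ?(ltW z0).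
  by apply: le_lt_trans br; rewrite ler_piMl ?(ltW z1).
split=> // i; rewrite gain_ge0//.
have := sum_gamma (fun k => zeta n sigma B lambda k * b) i.
rewrite -mulr_suml -/Z => SE.
have /andP[z0 _] := hz i; have /andP[zb0 _] := hb i.
(* Both sides carry the nonnegative factor [zeta i * b]. What remains, [gamma i + rho <= Z * rho],
   follows from [gamma i <= Z * b <= (Z - 1) * rho]. *)
rewrite (_ : _ * (Z * b) * _ = zeta n sigma B lambda i * b * (Z * rho n sigma)); last by ring.
rewrite ler_wpM2l//.
by lra.
Qed.

Theorem mainTheorem1 (R : realType) (N n : nat) (sigma B : R)
    (lambda : 'I_N -> R)
    (hN : (1 <= N)%N) (hn : (1 <= n)%N) (hsigma : 0 < sigma) (hB : 0 < B)
    (hlambda : forall i : 'I_N, 0 < lambda i) :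
  ((exists beta : 'I_N -> R,
      participation_solution n sigma B lambda beta /\ beta <> (fun _ => 0))
   <-> 1 < \sum_(i < N) zeta n sigma B lambda i)
  /\
  (1 < \sum_(i < N) zeta n sigma B lambda i ->
   forall b : R,
     0 <= b <= (1 - 1 / \sum_(i < N) zeta n sigma B lambda i) * rho n sigma ->
     participation_solution n sigma B lambda
       (fun i => zeta n sigma B lambda i * b)).
Proof.
split; last by move=> Z1 b; exact: zeta_solution.
split=> [[beta [sol nz]]|Z1].
(* If no coordinate were positive, the range constraint would force each to be zero. *)
- have /existsP[i bi] : [exists i, 0 < beta i].
    apply: contra_notT nz; rewrite negb_exists => /forallP nb.
    apply: boolp.funext => i; apply/eqP; rewrite eq_le leNgt nb/=.
    by have [/(_ i)/andP[]] := sol.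
  exact: sum_zeta_gt1 sol bi.
set Z := \sum_(i < N) _ in Z1 *.
(* The witness takes [b] at the right end of its interval, which is positive because [Z > 1]. *)
have b0 : 0 < (1 - 1 / Z) * rho n sigma.
  rewrite mulr_gt0 ?rho_gt0// subr_gt0 ltr_pdivrMr ?mul1r//.
  exact: lt_trans Z1.
exists (fun i => zeta n sigma B lambda i * ((1 - 1 / Z) * rho n sigma)); split.
  by apply: zeta_solution; rewrite // lexx ltW.
(* As [N >= 1], there is a client 0, whose coordinate is a product of positive numbers. *)
move=> /(congr1 (@^~ (Ordinal hN))) /eqP.
have /andP[z0 _] := zeta_itv hn hsigma hB (hlambda (Ordinal hN)).
by rewrite gt_eqF// mulr_gt0.
Qed.
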